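(* Let $(P,\succcurlyeq)$ be a re-chain-complete poset and let $F:P\to 2^{P}\setminus\{\emptyset\}$ be a set-valued mapping satisfying the following three conditions: (a) $F$ is order-increasing downward; (b) for every $x\in P$, $F(x)$ is universally re-inductive in $P$; (c) there are an element $y_*\in P$ and $v_*\in F(y_* )$ with $v_*\preccurlyeq y_*$. Let $\mathcal{F}(F)$ denote the set of fixed points of $F$. Then 1. $(\mathcal{F}(F),\succcurlyeq)$ is a nonempty re-inductive poset; 2. $(\mathcal{F}(F)\cap(y_*],\succcurlyeq)$ is a nonempty re-inductive poset. Consequently, (i) $F$ has an $\succcurlyeq$-minimal fixed point; (ii) $F$ has an $\succcurlyeq$-minimal fixed point $x^*$ with $x^*\preccurlyeq y_*$.
   Context: For a poset $(P,\succcurlyeq)$, $a\preccurlyeq b$ means $b\succcurlyeq a$. A chain is a nonempty totally ordered subset. $(P,\succcurlyeq)$ is re-inductive if every chain in $P$ has a lower bound in $P$; it is re-chain-complete if every chain in $P$ has a greatest lower bound in $P$. A nonempty subset $A\subseteq P$ is universally re-inductive in $P$ if, for every chain $\{x_\alpha\}\subseteq P$ such that every element $x_\beta$ of the chain has a lower cover in $A$ (i.e. there is $a\in A$ with $a\preccurlyeq x_\beta$), the chain $\{x_\alpha\}$ has a lower bound belonging to $A$. A set-valued mapping $F:P\to 2^{P}\setminus\{\emptyset\}$ is order-increasing downward if whenever $x\preccurlyeq y$ and $w\in F(y)$, there is $z\in F(x)$ with $z\preccurlyeq w$. A fixed point of $F$ is $x\in P$ with $x\in F(x)$; $\mathcal{F}(F)$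 is the set of fixed points, and an $\succcurlyeq$-minimal fixed point is a minimal element of $\mathcal{F}(F)$. For $y\in P$, $(y]=\{x\in P: x\preccurlyeq y\}$. *)

(* Defs.v *)
From mathcomp Require Import all_boot all_order.
From mathcomp Require Import boolp classical_sets.

Set Implicit Arguments.
Unset Strict Implicit.
Unset Printing Implicit Defensive.

Local Open Scope classical_set_scope.
Local Open Scope order_scope.

Section PosetNotions.
Context {d : Order.disp_t} {P : porderType d}.
Implicit Types (A C : set P) (x y z w : P) (F : P -> set P).

Definition is_chain C : Prop := C !=set0 /\ total_on C (fun x y => x <= y).

(* A stands for the poset (A, <=) with the induced order: a chain of the
   subposet A is a chain of P contained in A. *)
Definition re_inductive A : Prop :=
  forall C, C `<=` A -> is_chain C -> exists2 a, A a & lbound C a.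

Definition universally_re_inductive A : Prop :=
  A !=set0 /\
  forall C, is_chain C ->
    (forall x, C x -> exists2 a, A a & a <= x) ->
    exists2 a, A a & lbound C a.

Definition order_increasing_downward F : Prop :=
  forall x y w, x <= y -> F y w -> exists2 z, F x z & z <= w.

Definition fixed_points F : set P := [set x | F x x].

Definition minimal_in A x : Prop :=
  A x /\ forall y, A y -> y <= x -> y = x.

Definition down_set y : set P := [set x | x <= y].

End PosetNotions.

Definition re_chain_complete {d : Order.disp_t} (P : porderType d) : Prop :=
  forall C : set P, is_chain C -> infimums C !=set0.

(* Main.v *)
Require Import Defs.
From mathcomp Require Import all_boot all_order.
From mathcomp Require Import boolp classical_sets.

(** Say that [x] is decreasable when some [v] in [F x] lies below [x].  Fixed
    points are decreasable, so is [y_], and everything reduces to two facts.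

    A minimal decreasable point [m] is a fixed point: a [v] in [F m] below [m]
    is again decreasable, because [F] is order-increasing downward
    ([F_decreasable]), hence [v = m].  Since fixed points are decreasable, [m]
    is then also minimal among the fixed points.

    The infimum [u] of a chain of decreasable points is decreasable: each [x]
    in the chain has a [v] in [F x] below it, monotonicity moves [v] down to a
    point of [F u], and universal re-inductivity of [F u] provides one point
    of [F u] below the whole chain, hence below its greatest lower bound [u]
    ([decreasable_infimum]).

    By the second fact Zorn's lemma applies below any decreasable point, and
    by the first one it yields a minimal fixed point there
    ([minimal_fixed_point_below]).  Starting from [y_] this gives existence;
    starting from the infimum of a chain of fixed points it gives a fixed
    point below that chain. *)

Import Order.TTheory.

Local Open Scope classical_set_scope.
Local Open Scope order_scope.

(** Zorn's lemma in localized form, for a subset of a poset. *)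
Lemma re_inductive_minimal_below {d : Order.disp_t} {P : porderType d}
    (A : set P) (y : P) :
  re_inductive A -> A y -> exists2 m, minimal_in A m & m <= y.
Proof.
move=> indA Ay; pose T := {x : P | A x /\ x <= y}.
(* The maximal elements of the reversed order are the minimal ones sought. *)
have [|r s t rs st|[s As] [t At] /= ts st|C totC|[m [Am my]] minm] :=
  @Zorn T (fun s t => sval t <= sval s).
- by move=> t /=.
- exact: le_trans st rs.
- by apply: eq_exist; apply: le_anti; rewrite st ts.
- (* The empty set is not a chain, but it is bounded by [y] itself. *)
  have [[c Cc]|C0] := pselect (C !=set0); last first.
    by exists (exist _ y (conj Ay (lexx y))) => s Cs; case: C0; exists s.
  have [_ [s _ <-]||a Aa aC] := indA [set sval s | s in C].
  + exact: (svalP s).1.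
  + split; first by exists (sval c), c.
    by move=> _ _ [s Cs <-] [t Ct <-]; rewrite or_comm; exact: totC.
  + have ay : a <= y by apply: le_trans (svalP c).2; apply: aC; exists c.
    by exists (exist _ a (conj Aa ay)) => s Cs /=; apply: aC; exists s.
exists m => //; split=> // x Ax xm.
exact: (congr1 sval (minm (exist _ x (conj Ax (le_trans xm my))) xm)).
Qed.

Definition decreasable {d : Order.disp_t} {P : porderType d} (F : P -> set P) :
  set P := [set x | exists2 v, F x v & v <= x].

Section DecreasablePoints.
Context {d : Order.disp_t} {P : porderType d}.
Variable F : P -> set P.
Hypothesis F_down : order_increasing_downward F.

Lemma fixed_decreasable : fixed_points F `<=` decreasable F.
Proof. by move=> x Fx; exists x. Qed.

Lemma F_decreasable (x v : P) : F x v -> v <= x -> decreasable F v.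
Proof. by move=> Fxv vx; exact: F_down vx Fxv. Qed.

Lemma minimal_decreasable_fixed (m : P) :
  minimal_in (decreasable F) m -> minimal_in (fixed_points F) m.
Proof.
move=> [[v Fmv vm] minm]; split.
  by have vE := minm v (F_decreasable _ _ Fmv vm) vm; rewrite vE in Fmv.
by move=> x /fixed_decreasable; exact: minm.
Qed.

Hypothesis F_uri : forall x, universally_re_inductive (F x).

(** Universal re-inductivity is applied to the chain [C] itself, whose points
    have lower covers in [F u]; those covers need not form a chain. *)
Lemma decreasable_infimum (C : set P) (u : P) :
  is_chain C -> C `<=` decreasable F -> infimums C u -> decreasable F u.
Proof.
move=> chC CD [uC u_max]; have [_ indFu] := F_uri u.
have [x Cx|a Fua aC] := indFu C chC.
  have [v Fxv vx] := CD x Cx; have [z Fuz zv] := F_down _ _ _ (uC x Cx) Fxv.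
  by exists z => //; exact: le_trans zv vx.
by exists a => //; exact: u_max.
Qed.

Hypothesis P_complete : re_chain_complete P.

Lemma minimal_fixed_point_below (y : P) :
  decreasable F y -> exists2 m, minimal_in (fixed_points F) m & m <= y.
Proof.
have indD : re_inductive (decreasable F).
  move=> C CD chC; have [u Cu] := P_complete C chC.
  by exists u; [exact: decreasable_infimum Cu|exact: Cu.1].
move=> /(re_inductive_minimal_below _ _ indD)[m minm my].
by exists m => //; exact: minimal_decreasable_fixed.
Qed.

Lemma re_inductive_fixed_points : re_inductive (fixed_points F).
Proof.
move=> C CF chC; have [u Cu] := P_complete C chC.
have /minimal_fixed_point_below[m [Fm _] mu] : decreasable F u.
  exact: decreasable_infimum chC (subset_trans CF fixed_decreasable) Cu.
by exists m => // x Cx; apply: le_trans mu (Cu.1 x Cx).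
Qed.

End DecreasablePoints.

Lemma re_inductive_down_set {d : Order.disp_t} {P : porderType d}
    (A : set P) (y : P) :
  re_inductive A -> re_inductive (A `&` down_set y).
Proof.
move=> indA C; rewrite subsetI => -[CA Cy] chC; have [a Aa aC] := indA C CA chC.
have [c Cc] := chC.1; exists a => //; split=> //.
exact: le_trans (aC c Cc) (Cy c Cc).
Qed.

Theorem theorem5p1 (d : Order.disp_t) (P : porderType d) (F : P -> set P)
    (y_ v_ : P)
    (P_complete : re_chain_complete P)
    (F_nonempty : forall x : P, F x !=set0)
    (F_down : order_increasing_downward F)
    (F_uri : forall x : P, universally_re_inductive (F x))
    (F_v : F y_ v_)
    (v_le_y : v_ <= y_) :
  [/\ fixed_points F !=set0 /\ re_inductive (fixed_points F),
      fixed_points F `&` down_set y_ !=set0 /\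
        re_inductive (fixed_points F `&` down_set y_),
      exists x : P, minimal_in (fixed_points F) x
    & exists2 x : P, minimal_in (fixed_points F) x & x <= y_].
Proof.
have [|m minm my] := minimal_fixed_point_below F F_down F_uri P_complete y_.
  by exists v_.
have indF := re_inductive_fixed_points F F_down F_uri P_complete.
split.
- by split=> //; exists m; exact: minm.1.
- split; last exact: re_inductive_down_set.
  by exists m; split=> //; exact: minm.1.
- by exists m.
- by exists m.
Qed.
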